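(* For every finite signed graph $(G,\sigma)$ with no positive bridge, $$\Phi_c(G,\sigma)=\min\Big\{\frac pq:\ (G,\sigma)\text{ admits a circular }\frac pq\text{-flow},\ p,q\in\mathbb{Z},\ 1\le 2q\le p\le 2|E(G)|\Big\}.$$ In particular, $\Phi_c(G,\sigma)$ is a rational number.
   Context: Graphs may have multiple edges but no loops; a signed graph $(G,\sigma)$ has $\sigma:E(G)\to\{+,-\}$; a positive bridge is a bridge of $G$ whose sign is $+$. For an orientation $D$ and $f:E(G)\to\mathbb{R}$, $\partial_Df(v)$ is the sum of $f$ over out-arcs at $v$ minus the sum over in-arcs. A circular $r$-flow ($r\ge2$) is a pair $(D,f)$ with $D$ an orientation of $G$ and $f:E(G)\to(-r,r)$ such that $|f(e)|\in[1,r-1]$ for positive edges, $|f(e)|\in[0,\frac r2-1]\cup[\frac r2+1,r)$ for negative edges, and $\partial_Df(v)=0$ at every vertex. The circular flow index $\Phi_c(G,\sigma)$ is the infimum of $r$ for which $(G,\sigma)$ admits a circular $r$-flow. *)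

(* Defs.v *)
From HB Require Import structures.
From mathcomp Require Import all_boot all_order all_algebra.
From mathcomp Require Import boolp classical_sets reals.

Set Implicit Arguments.
Unset Strict Implicit.
Unset Printing Implicit Defensive.

Import Order.TTheory GRing.Theory Num.Theory.
Local Open Scope ring_scope.

(* Finite multigraphs without loops: distinct edges may have the same ends. *)
Record multigraph := Multigraph {
  vertex : finType;
  edge : finType;
  ends : edge -> {set vertex};
  card_ends : forall e, #|ends e| = 2%N
}.

Variant sign := Pos | Neg.

(* Adjacency in the graph obtained from G by deleting the edge e. *)
Definition adj_del (G : multigraph) (e : edge G) : rel (vertex G) :=
  fun x y => [exists e' : edge G, (e' != e) && (ends e' == [set x; y]%SET)].

(* A bridge is an edge that separates its two ends. *)
Definition bridge (G : multigraph) (e : edge G) : Prop :=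
  exists x y : vertex G,
    ends e = [set x; y]%SET /\ ~~ connect (adj_del e) x y.

Definition positive_bridge (G : multigraph) (sigma : edge G -> sign)
    (e : edge G) : Prop :=
  bridge e /\ sigma e = Pos.

Record orientation (G : multigraph) := Orientation {
  tail : edge G -> vertex G;
  head : edge G -> vertex G;
  orientation_ends : forall e, ends e = [set tail e; head e]%SET
}.

Section CircularFlow.
Variables (R : realType) (G : multigraph).
Implicit Types (sigma : edge G -> sign) (D : orientation G) (f : edge G -> R).

Definition boundary D f (v : vertex G) : R :=
  \sum_(e | tail D e == v) f e - \sum_(e | head D e == v) f e.

Definition circular_flow sigma (r : R) D f : Prop :=
  [/\ forall e, - r < f e < r,
      forall e, sigma e = Pos -> 1 <= `|f e| <= r - 1,
      forall e, sigma e = Neg ->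
        (0 <= `|f e| <= r / 2 - 1) \/ (r / 2 + 1 <= `|f e| < r)
    & forall v, boundary D f v = 0].

Definition admits_circular_flow sigma (r : R) : Prop :=
  2 <= r /\ exists D f, circular_flow sigma r D f.

Definition circular_flow_index sigma : R :=
  inf (fun r : R => admits_circular_flow sigma r).

Definition bounded_flow_fractions sigma : set R :=
  fun r => exists p q : int,
    [/\ 1 <= 2 * q, 2 * q <= p, p <= 2 * #|edge G|%:Z,
        r = p%:~R / q%:~R & admits_circular_flow sigma (p%:~R / q%:~R)].

End CircularFlow.

Arguments circular_flow_index R {G} sigma.
Arguments bounded_flow_fractions R {G} sigma _.

Definition is_minimum (R : realType) (S : set R) (m : R) : Prop :=
  S m /\ lbound S m.

(* Main.v *)
Require Import Defs.
From HB Require Import structures.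
From mathcomp Require Import all_boot all_order all_algebra.
From mathcomp Require Import boolp classical_sets reals.
From mathcomp Require Import lra zify.

Set Implicit Arguments.
Unset Strict Implicit.
Unset Printing Implicit Defensive.

Import Order.TTheory GRing.Theory Num.Theory.
Local Open Scope ring_scope.

(** Fix an orientation.  Up to the strict bound [|f e| < r], a circular r-flow
    is a circulation choosing on each edge one of finitely many intervals whose
    ends are affine in r.  Hoffman's theorem says that such a circulation exists
    iff every cut satisfies a linear inequality [2 M <= r N], where N is an
    integer and M counts edges of the cut, so M <= |E|.  Hence below every
    feasible r there is a feasible radius that is 2 or some 2M / N.  The bound
    [|f e| < r] is recovered by integrality in Hoffman's theorem: subtract r
    times a circulation obtained by rounding f / r.  Some flow exists because,
    again by Hoffman's theorem, each edge that is not a bridge supports a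
    circulation, and a generic linear combination of these is nonzero on all
    positive edges. *)

Local Notation head := Defs.head.

Lemma ex_common_nonroot (R : numDomainType) (I : finType) (p : I -> {poly R}) :
  (forall i, p i != 0) -> exists x, forall i, (p i).[x] != 0.
Proof.
move=> p_neq0; pose q := \prod_i p i.
have q_neq0 : q != 0 by apply/prodf_neq0.
pose natR (i : nat) : R := i%:R; pose xs := map natR (iota 0 (size q)).
have /allPn[x _ qx] : ~~ all (root q) xs.
  apply: contraL (leqnn (size q)) => xs_roots.
  rewrite -ltnNge -[X in (X < _)%N](size_iota 0) -(size_map natR).
  apply: max_poly_roots => //.
  by rewrite map_inj_uniq ?iota_uniq //; apply/mulrIn/oner_neq0.
exists x => i; apply: contraNneq qx => px0.
by rewrite /root /q (bigD1 i) //= hornerM px0 mul0r.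
Qed.

(* The coefficients are powers of a common nonroot of the polynomials whose
   coefficients are the columns of c. *)
Lemma ex_lincomb_neq0 (R : numDomainType) (I J : finType) (c : I -> J -> R) :
  (forall j, exists i, c i j != 0) ->
  exists a : I -> R, forall j, \sum_i a i * c i j != 0.
Proof.
move=> c_neq0; pose p j := \sum_i c i j *: 'X^(enum_rank i) : {poly R}.
have coef_p i j : (p j)`_(enum_rank i) = c i j.
  rewrite coef_sum (bigD1 i) //= coefZ coefXn eqxx mulr1 big1 ?addr0 // => i'.
  rewrite coefZ coefXn (inj_eq val_inj) (inj_eq enum_rank_inj) eq_sym.
  by move=> /negPf->; rewrite mulr0.
have [j|x p_x] := @ex_common_nonroot R J p.
  have [i] := c_neq0 j; rewrite -coef_p; apply: contraNneq => ->.
  by rewrite coef0.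
exists (fun i => x ^+ enum_rank i) => j; apply: contraNneq (p_x j) => sum0.
rewrite horner_sum -[X in _ == X]sum0; apply/eqP/eq_bigr => i _.
by rewrite hornerZ hornerXn mulrC.
Qed.

Lemma ex_affine_solution_le (R : realFieldType) (I : finType) (a b : I -> R)
    (c r : R) :
  0 < c -> c <= r -> (forall i, 0 <= b i <= r * a i) ->
  exists s, [/\ c <= s, s <= r, forall i, b i <= s * a i
    & s = c \/ exists2 i, 0 < a i & s = b i / a i].
Proof.
move=> c_gt0 cr abr; pose s := \big[Num.max/c]_(i | 0 < a i) (b i / a i).
have cs : c <= s by apply: bigmax_ge_id.
exists s; split=> // [|i|].
- apply: bigmax_le => // i ai_gt0; rewrite ler_pdivrMr //.
  by case/andP: (abr i).
- have [ai_gt0|ai_le0] := ltP 0 (a i).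
    by rewrite -ler_pdivrMr //; apply: le_bigmax_cond.
  have /andP[bi_ge0 bi_le] := abr i.
  have : r * a i <= 0 by rewrite mulr_ge0_le0 //; lra.
  move=> rai; have /eqP : r * a i = 0 by lra.
  by rewrite mulf_eq0 gt_eqF /= => [/eqP ai0|]; rewrite ?ai0 ?mulr0; lra.
- rewrite /s; elim/big_ind: _ => [|x y ? ?|i ai_gt0]; first by left.
    by case: (leP x y).
  by right; exists i.
Qed.

Lemma inf_minimum (R : realType) (S : set R) (m : R) :
  is_minimum S m -> inf S = m.
Proof.
move=> [Sm m_lb]; apply/eqP; rewrite eq_le ge_inf //; last by exists m.
by rewrite lb_le_inf //; exists m.
Qed.

Lemma inhabited_orientation (G : multigraph) : inhabited (orientation G).
Proof.
have ex_ends (e : edge G) :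
    exists z : vertex G * vertex G, ends e = [set z.1; z.2]%SET.
  have /eqP/cards2P[x [y [_ ends_e]]] := card_ends e.
  by exists (x, y).
have [z ends_z] := boolp.choice ex_ends.
exact: inhabits (Orientation ends_z).
Qed.

(** * Hoffman's circulation theorem *)

Section Circulation.
Variables (R : realType) (G : multigraph) (D : orientation G).
Implicit Types (f g l u : edge G -> R) (X Y : {set vertex G}) (e : edge G).

Lemma boundaryE f v :
  boundary D f v = \sum_e f e * ((tail D e == v)%:R - (head D e == v)%:R).
Proof.
rewrite /boundary big_mkcond [X in _ - X]big_mkcond -sumrB /=.
apply: eq_bigr => e _; rewrite mulrBr.
by do 2!case: eqP => _; rewrite ?mulr1 ?mulr0.
Qed.

Definition circulation f : Prop := forall v, boundary D f v = 0.

Lemma circulationB f g :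
  circulation f -> circulation g -> circulation (fun e => f e - g e).
Proof.
move=> f_circ g_circ v; rewrite boundaryE.
under eq_bigr do rewrite mulrBl.
by rewrite sumrB -!boundaryE f_circ g_circ subrr.
Qed.

Lemma circulationZ a f : circulation f -> circulation (fun e => a * f e).
Proof.
move=> f_circ v; rewrite boundaryE.
by under eq_bigr do rewrite -mulrA; rewrite -mulr_sumr -boundaryE f_circ mulr0.
Qed.

Lemma circulation_sum (I : finType) (f : I -> edge G -> R) :
  (forall i, circulation (f i)) -> circulation (fun e => \sum_i f i e).
Proof.
move=> f_circ v; rewrite boundaryE.
under eq_bigr do rewrite mulr_suml.
by rewrite exchange_big big1 //= => i _; rewrite -boundaryE f_circ.
Qed.

Definition leaves X e : bool := (tail D e \in X) && (head D e \notin X).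

Definition crosses X e : bool := leaves X e || leaves (~: X) e.

Definition cut_slack l u X : R :=
  \sum_(e | leaves X e) u e - \sum_(e | leaves (~: X) e) l e.

Lemma cut_slackE l u X :
  cut_slack l u X =
    \sum_e ((leaves X e)%:R * u e - (leaves (~: X) e)%:R * l e).
Proof.
rewrite /cut_slack big_mkcond [X in _ - X]big_mkcond -sumrB.
by apply: eq_bigr => e _; rewrite !mulr_natl !mulrb.
Qed.

Lemma sum_boundary_cut f X : \sum_(v in X) boundary D f v = cut_slack f f X.
Proof.
have sum_fibers (h : edge G -> vertex G) :
    \sum_(v in X) \sum_(e | h e == v) f e = \sum_(e | h e \in X) f e.
  rewrite [RHS](partition_big h (mem X)) //; apply: eq_bigr => v vX.
  by apply: eq_bigl => e; rewrite andb_idl // => /eqP->.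
rewrite sumrB !sum_fibers cut_slackE big_mkcond [Z in _ - Z]big_mkcond -sumrB.
apply: eq_bigr => e _; rewrite /leaves !inE.
by case: (_ \in X); case: (_ \in X) => /=; lra.
Qed.

Lemma circulation_cut_slack_ge0 l u f X :
  circulation f -> (forall e, l e <= f e <= u e) -> 0 <= cut_slack l u X.
Proof.
move=> f_circ lfu; have <- : cut_slack f f X = 0.
  by rewrite -sum_boundary_cut big1.
by rewrite lerB //; apply: ler_sum => e _; case/andP: (lfu e).
Qed.

(* An edge from X \ Y to Y \ X counts on the right but not on the left. *)
Lemma cut_slack_submodular l u X Y e0 :
  (forall e, l e <= u e) -> leaves X e0 -> leaves (~: Y) e0 ->
  (u e0 - l e0) + (cut_slack l u (X :&: Y) + cut_slack l u (X :|: Y))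
    <= cut_slack l u X + cut_slack l u Y.
Proof.
move=> lu Xe0 Ye0; rewrite !cut_slackE -!big_split /=.
rewrite (bigD1 e0) //= [leRHS](bigD1 e0) //= [leLHS]addrA lerD //.
  move: Xe0 Ye0; rewrite /leaves !inE negbK.
  by move=> /andP[-> /negPf->] /andP[/negPf-> ->] /=; lra.
apply: ler_sum => e _; rewrite /leaves !inE.
by do 4!case: (_ \in _) => /=; have := lu e; lra.
Qed.

Lemma cut_slack_with l u e0 x X :
  cut_slack [eta l with e0 |-> x] [eta u with e0 |-> x] X =
    cut_slack l u X - (leaves X e0)%:R * (u e0 - x)
                    - (leaves (~: X) e0)%:R * (x - l e0).
Proof.
rewrite !cut_slackE (bigD1 e0) //= [X in _ = X - _ - _](bigD1 e0) //= eqxx.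
under eq_bigr => e /negPf e_neq do rewrite e_neq.
by lra.
Qed.

Section Hoffman.
Variables (l u : edge G -> R).
Hypothesis lu : forall e, l e <= u e.
Hypothesis slack_ge0 : forall X, 0 <= cut_slack l u X.

(* The cuts left by e0 bound x from below and those entered by e0 bound it from
   above; submodularity makes each lower bound at most each upper bound. *)
Lemma ex_edge_value_cut_slack_ge0 e0 :
  exists x, [/\ l e0 <= x <= u e0,
    forall X, 0 <= cut_slack [eta l with e0 |-> x] [eta u with e0 |-> x] X
  & forall S : zmodClosed R,
      (forall e, (l e \in S) && (u e \in S)) -> x \in S].
Proof.
pose x := \big[Num.max/l e0]_(X | leaves X e0) (u e0 - cut_slack l u X).
have lx : l e0 <= x by apply: bigmax_ge_id.
have xu : x <= u e0 by apply: bigmax_le => // X _; rewrite gerBl.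
exists x; split=> [|X|S luS]; first by rewrite lx.
- rewrite cut_slack_with.
  have [Xe0|] := boolP (leaves X e0).
    have -> : leaves (~: X) e0 = false.
      by move: Xe0; rewrite /leaves !inE => /andP[-> _].
    have : u e0 - cut_slack l u X <= x by apply: le_bigmax_cond.
    by rewrite /=; lra.
  have [Xe0 _|_ _] := boolP (leaves (~: X) e0); last first.
    by have := slack_ge0 X; rewrite /=; lra.
  suff : x <= l e0 + cut_slack l u X by rewrite /=; lra.
  apply: bigmax_le => [|Y Ye0]; first by have := slack_ge0 X; lra.
  have := cut_slack_submodular lu Ye0 Xe0.
  by have := slack_ge0 (Y :&: X); have := slack_ge0 (Y :|: X); lra.
- rewrite /x; elim/big_ind: _ => [|y z yS zS|X _].
  + by case/andP: (luS e0).
  + by case: (leP y z).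
  + have [_ ue0S] := andP (luS e0).
    by rewrite !rpredB // rpred_sum // => e _; case/andP: (luS e).
Qed.

End Hoffman.

Lemma cut_slack_ge0_circulation f :
  (forall X, 0 <= cut_slack f f X) -> circulation f.
Proof.
move=> slack_ge0 v.
have boundary_ge0 w : 0 <= boundary D f w.
  by rewrite -(big_set1 +%R w (boundary D f)) sum_boundary_cut.
have : \sum_(w in [set: vertex G]%SET) boundary D f w = 0.
  rewrite sum_boundary_cut cut_slackE big1 // => e _.
  by rewrite /leaves !inE /= !mul0r subrr.
by move=> /psumr_eq0P-> //; rewrite inE.
Qed.

(* Taking the integers for S gives integrality when the bounds are integers. *)
Theorem hoffman_circulation l u :
  (forall e, l e <= u e) -> (forall X, 0 <= cut_slack l u X) ->
  exists f, [/\ circulation f, forall e, l e <= f e <= u e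
    & forall S : zmodClosed R,
        (forall e, (l e \in S) && (u e \in S)) -> forall e, f e \in S].
Proof.
have [n] := ubnP #|[set e | l e != u e]%SET|.
elim: n => // n IHn in l u *; rewrite ltnS => card_le lu slack_ge0.
have [/forallP eq_lu|] := boolP [forall e, l e == u e].
  have {}eq_lu : l = u by apply/funext => e; apply/eqP.
  rewrite -{}eq_lu in lu slack_ge0 *; exists l.
  split=> [|e|S lS e]; [exact: cut_slack_ge0_circulation | by rewrite !lexx |].
  by case/andP: (lS e).
rewrite negb_forall => /existsP[e0 lu_e0].
have [x [/andP[lx xu] x_slack xS]] :=
  ex_edge_value_cut_slack_ge0 lu slack_ge0 e0.
have [|e /=|f [f_circ lfu fS]] := IHn _ _ _ _ x_slack.
- apply: leq_trans card_le; apply: proper_card.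
  apply/properP; split; last by exists e0; rewrite !inE //= !eqxx.
  by apply/fintype.subsetP => e; rewrite !inE /=; case: (e =P e0) => [->|].
- by case: eqP.
exists f; split=> // [e|S luS e].
  have := lfu e; rewrite /=; case: eqP => // -> /andP[xf fx].
  by rewrite (le_trans lx xf) (le_trans fx xu).
by apply: fS => e' /=; case: eqP; rewrite ?xS.
Qed.

Lemma ex_circulation_round f : circulation f ->
  exists c, [/\ circulation c, forall e, c e \is a Num.int
    & forall e, `|f e - c e| < 1].
Proof.
move=> f_circ.
pose l e : R := (Num.floor (f e))%:~R; pose u e : R := (Num.ceil (f e))%:~R.
have lf e : l e <= f e by apply: floor_le.
have fu e : f e <= u e by apply: ceil_ge.
have [|X|c [c_circ lcu cZ]] := @hoffman_circulation l u.
- by move=> e; apply: le_trans (lf e) (fu e).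
- by apply: (circulation_cut_slack_ge0 X f_circ) => e; rewrite lf fu.
exists c; split=> // [e|e]; first by apply: cZ => e'; rewrite !intr_int.
have := floorD1_gt (f e); have := ceilB1_lt (f e); have /andP[] := lcu e.
by rewrite intrB intrD /l /u ltr_norml; lra.
Qed.

Lemma ex_crosses_nonbridge e0 X : ~ bridge e0 -> crosses X e0 ->
  exists2 e, e != e0 & crosses X e.
Proof.
move=> e0_nonbridge Xe0.
have e0_conn : connect (adj_del e0) (tail D e0) (head D e0).
  apply/negPn/negP => nconn; apply: e0_nonbridge.
  by exists (tail D e0), (head D e0); split; first exact: orientation_ends.
have [/exists_inP[]|none] := boolP [exists (e | e != e0), crosses X e].
  by move=> e; exists e.
have X_closed : closed (adj_del e0) (mem X).
  move=> x y /existsP[e /andP[e_neq /eqP ends_e]].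
  have inX z : z \in ends e -> (z \in X) = (tail D e \in X).
    rewrite (orientation_ends D) => /set2P[-> //|->].
    apply: contraNeq none => cross; apply/exists_inP; exists e => //.
    by move: cross; rewrite /crosses /leaves !inE; do 2!case: (_ \in _).
  by rewrite !inX ?ends_e ?set21 ?set22.
move: Xe0; rewrite /crosses /leaves !inE.
have /= -> := closed_connect X_closed e0_conn.
by case: (_ \in _).
Qed.

Lemma nonbridge_cut_slack_ge0 e0 X : ~ bridge e0 ->
  0 <= cut_slack [eta (fun=> -1) with e0 |-> 1] (fun=> 1) X.
Proof.
move=> e0_nonbridge; rewrite cut_slackE; set F := BIG_F.
have F_ge e : e != e0 -> (crosses X e)%:R <= F e.
  move=> /negPf e_neq; rewrite /F /= e_neq /crosses /leaves !inE.
  by do 2!case: (_ \in _) => /=; lra.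
have F_ge0 e : e != e0 -> 0 <= F e.
  by move=> /F_ge; apply: le_trans; apply: ler0n.
have F_e0 : - (crosses X e0)%:R <= F e0.
  rewrite /F /= eqxx /crosses /leaves !inE.
  by do 2!case: (_ \in _) => /=; lra.
have [Xe0|Xe0] := boolP (crosses X e0); last first.
  rewrite (bigD1 e0) //= addr_ge0 ?sumr_ge0 //.
  by move: F_e0; rewrite (negPf Xe0) oppr0.
have [e1 e1_neq Xe1] := ex_crosses_nonbridge e0_nonbridge Xe0.
rewrite (bigD1 e0) //= (bigD1 e1) //= addrA addr_ge0 ?sumr_ge0 //.
  by move: F_e0 (F_ge _ e1_neq); rewrite Xe0 Xe1; lra.
by move=> e /andP[/F_ge0].
Qed.

Lemma ex_circulation_nonbridge e0 : ~ bridge e0 ->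
  exists2 f, circulation f & f e0 != 0.
Proof.
move=> e0_nonbridge.
have [e /=|X|f [f_circ f_val _]] :=
  @hoffman_circulation [eta (fun=> -1) with e0 |-> 1] (fun=> 1).
- by case: ifP => _; lra.
- exact: nonbridge_cut_slack_ge0.
exists f => //; have := f_val e0; rewrite /= eqxx => /andP[f_ge1 _].
by rewrite gt_eqF //; lra.
Qed.

Lemma ex_circulation_neq0 (P : pred (edge G)) :
  (forall e, P e -> ~ bridge e) ->
  exists2 f, circulation f & forall e, P e -> f e != 0.
Proof.
move=> P_nonbridge.
have [c c_circ c_neq0] : exists2 c : {e | P e} -> edge G -> R,
    forall i, circulation (c i) & forall i, c i (val i) != 0.
  have /boolp.choice[c cP] (i : {e | P e}) :
      exists f, circulation f /\ f (val i) != 0.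
    have [f] := ex_circulation_nonbridge (P_nonbridge _ (valP i)).
    by exists f.
  by exists c => i; case: (cP i).
have [j|a a_neq0] :=
  @ex_lincomb_neq0 R {e | P e} {e | P e} (fun i j => c i (val j)).
  by exists j.
exists (fun e => \sum_i a i * c i e) => [|e Pe].
  by apply: circulation_sum => i; apply: circulationZ.
exact: (a_neq0 (exist _ e Pe)).
Qed.

End Circulation.

(** * Closed and circular flows *)

Section CircularFlow.
Variables (R : realType) (G : multigraph) (sigma : edge G -> sign).
Implicit Types (D : orientation G) (f : edge G -> R) (r x : R) (s : sign).

(* Unlike in a circular r-flow, the absolute value r is allowed on a negative
   edge. *)
Definition closed_value s r x : Prop :=
  match s with
  | Pos => 1 <= x <= r - 1
  | Neg => 0 <= x <= r / 2 - 1 \/ r / 2 + 1 <= x <= r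
  end.

Lemma closed_value_le s r x : 2 <= r -> closed_value s r x -> x <= r.
Proof. by case: s => /=; [lra | move=> ? []; lra]. Qed.

Lemma closed_value_sub s r x :
  0 < x <= r -> closed_value s r x -> closed_value s r (r - x).
Proof. by case: s => /= ?; [lra | case=> ?; [right | left]; lra]. Qed.

Lemma circular_flow_closed_value r D f e :
  circular_flow sigma r D f -> closed_value (sigma e) r `|f e|.
Proof.
move=> [_ f_pos f_neg _]; case sigma_e: (sigma e) => /=; first exact: f_pos.
by case: (f_neg e sigma_e) => [?|/andP[? /ltW ?]]; [left | right; apply/andP].
Qed.

Lemma circular_flow_of_closed_value r D f :
  circulation D f ->
  (forall e, closed_value (sigma e) r `|f e| /\ `|f e| < r) ->
  circular_flow sigma r D f.
Proof.
move=> f_circ f_val; split=> // e; first by rewrite -ltr_norml; case: (f_val e).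
  by move=> sigma_e; case: (f_val e); rewrite sigma_e.
move=> sigma_e; case: (f_val e); rewrite sigma_e /= => -[? _|/andP[? _] ?].
  by left.
by right; apply/andP.
Qed.

Lemma closed_value_subr_int s r x (n : int) :
  2 <= r -> closed_value s r `|x| -> `|x - r * n%:~R| < r ->
  closed_value s r `|x - r * n%:~R|.
Proof.
move=> r_ge2 x_val; rewrite ltr_norml => /andP[lt_x x_lt].
have x_le := closed_value_le r_ge2 x_val; have r_gt0 : 0 < r by lra.
have [x_geN x_ler] : - r <= x /\ x <= r by apply/andP; rewrite -ler_norml.
have n_lt2 : n < 2 by rewrite -(ltr_int R) -(ltr_pM2l r_gt0); lra.
have n_gtN2 : -2 < n by rewrite -(ltr_int R) -(ltr_pM2l r_gt0); lra.
have : n \in [:: -1; 0; 1] by rewrite !inE; lia.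
rewrite !inE => /or3P[] /eqP n_eq; move: lt_x x_lt; rewrite n_eq => lt_x x_lt.
- have x_lt0 : x < 0 by lra.
  have -> : `|x - r * (-1)%:~R| = r - `|x|.
    by rewrite (ltr0_norm x_lt0) ger0_norm; lra.
  by apply: closed_value_sub x_val; rewrite x_le normr_gt0 lt_eqF.
- by rewrite mulr0 subr0.
- have x_gt0 : 0 < x by lra.
  have -> : `|x - r * 1%:~R| = r - `|x|.
    by rewrite (gtr0_norm x_gt0) ler0_norm; lra.
  by apply: closed_value_sub x_val; rewrite x_le normr_gt0 gt_eqF.
Qed.

Lemma ex_circular_flow_of_closed_value r D f :
  2 <= r -> circulation D f -> (forall e, closed_value (sigma e) r `|f e|) ->
  exists g, circular_flow sigma r D g.
Proof.
move=> r_ge2 f_circ f_val; have r_gt0 : 0 < r by lra.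
have [c [c_circ cZ c_near]] := ex_circulation_round (circulationZ r^-1 f_circ).
exists (fun e => f e - r * c e); apply: circular_flow_of_closed_value => [|e].
  exact: (circulationB f_circ (circulationZ r c_circ)).
have near : `|f e - r * c e| < r.
  have -> : f e - r * c e = r * (r^-1 * f e - c e).
    by rewrite mulrBr mulrA divff ?mul1r // gt_eqF.
  by rewrite normrM gtr0_norm // gtr_pMr.
have [n c_eq] := intrP (cZ e).
by split=> //; rewrite c_eq; apply: closed_value_subr_int; rewrite -?c_eq.
Qed.

Lemma ex_admits_circular_flow :
  (forall e, ~ positive_bridge sigma e) ->
  exists r : R, admits_circular_flow sigma r.
Proof.
move=> no_pos_bridge; have [D] := inhabited_orientation G.
have [f f_circ f_neq0] : exists2 f : edge G -> R, circulation D f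
    & forall e, sigma e = Pos -> f e != 0.
  have [e|f f_circ f_neq0] := @ex_circulation_neq0 R G D
      (fun e => if sigma e is Pos then true else false).
    by case sigma_e: (sigma e) => // _ e_bridge; apply: (no_pos_bridge e).
  by exists f => // e sigma_e; apply: f_neq0; rewrite sigma_e.
pose a := \sum_e `|f e|^-1; pose g e := a * f e; pose b := \sum_e `|g e|.
have g_le e : `|g e| <= b by rewrite /b (bigD1 e) //= lerDl sumr_ge0.
have b_ge0 : 0 <= b by rewrite sumr_ge0.
exists (2 * b + 2); split; first by lra.
exists D, g; apply: circular_flow_of_closed_value; first exact: circulationZ.
move=> e; have g_e_le := g_le e; have g_e_ge0 := normr_ge0 (g e).
split; last by lra.
case sigma_e: (sigma e) => /=; last by left; lra.
suff : 1 <= `|g e| by lra.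
have f_e_gt0 : 0 < `|f e| by rewrite normr_gt0 f_neq0.
have a_ge : `|f e|^-1 <= a.
  by rewrite /a (bigD1 e) //= lerDl sumr_ge0 // => e' _; rewrite invr_ge0.
rewrite /g normrM -ler_pdivrMr // mul1r.
exact: le_trans a_ge (ler_norm a).
Qed.

(** * Cut inequalities and the radius *)

(* [lower s (b, c) r] and [upper s (b, c) r] below are the ends of an interval
   of admissible values for an edge of sign s.  On a positive edge, and on a
   negative edge when c = true (the intervals away from 0), b tells whether the
   values are positive; on a negative edge, c = false gives the interval around
   0. *)
Definition slope s (k : bool * bool) : int :=
  match s, k with
  | Pos, (true, _) => 2
  | Pos, (false, _) => 0
  | Neg, (_, false) => 1
  | Neg, (true, true) => 2
  | Neg, (false, true) => -1
  end.

Definition offset s (k : bool * bool) : nat :=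
  match s, k with
  | Neg, (true, true) => 0
  | _, _ => 1
  end.

Definition upper s k r : R := r / 2 * (slope s k)%:~R - (offset s k)%:R.

Definition mirror (k : bool * bool) : bool * bool := (~~ k.1, k.2).

Definition lower s k r : R := - upper s (mirror k) r.

Lemma lower_le_upper s k r : 2 <= r -> lower s k r <= upper s k r.
Proof. by rewrite /lower /upper; case: s; case: k => [[] []] /=; lra. Qed.

Lemma closed_value_intervalP s r x : 2 <= r ->
  closed_value s r `|x| <-> exists k, lower s k r <= x <= upper s k r.
Proof.
move=> r_ge2; rewrite /lower /upper; split.
  case: s => /=; case: (ger0P x) => x_sign.
  - by exists (true, true) => /=; lra.
  - by exists (false, true) => /=; lra.
  - by case=> ?; [exists (true, false) | exists (true, true)] => /=; lra.
  - by case=> ?; [exists (true, false) | exists (false, true)] => /=; lra.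
by case: s => -[[[] []]] /=; case: (ger0P x) => x_sign; lra.
Qed.

Section CutFraction.
Variables (D : orientation G) (k : edge G -> bool * bool).
Let lowers r e := lower (sigma e) (k e) r.
Let uppers r e := upper (sigma e) (k e) r.
Implicit Types X : {set vertex G}.

Definition cut_slope X : int :=
  \sum_(e | leaves D X e) slope (sigma e) (k e)
  + \sum_(e | leaves D (~: X) e) slope (sigma e) (mirror (k e)).

Definition cut_offset X : nat :=
  \sum_(e | leaves D X e) offset (sigma e) (k e)
  + \sum_(e | leaves D (~: X) e) offset (sigma e) (mirror (k e)).

Lemma cut_offset_le X : (cut_offset X <= #|edge G|)%N.
Proof.
have offset_le1 s j : (offset s j <= 1)%N by case: s; case: j => [[] []].
rewrite /cut_offset big_mkcond [Z in (_ + Z)%N]big_mkcond -big_split -sum1_card.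
apply: leq_sum => e _; rewrite /leaves !inE.
by do 2!case: (_ \in _) => /=; rewrite ?addn0 ?add0n ?offset_le1.
Qed.

Lemma cut_slack_lower_upper r X :
  cut_slack D (lowers r) (uppers r) X
  = r / 2 * (cut_slope X)%:~R - (cut_offset X)%:R.
Proof.
rewrite /cut_slack /lowers /uppers sumrN opprK !sumrB -!mulr_sumr.
by rewrite /cut_slope /cut_offset intrD natrD !rmorph_sum /=; lra.
Qed.

Lemma ex_interval_circulation_le r f :
  2 <= r -> circulation D f ->
  (forall e, lowers r e <= f e <= uppers r e) ->
  exists t, [/\ 2 <= t, t <= r,
    exists2 g, circulation D g
      & forall e, lowers t e <= g e <= uppers t e
  & t = 2 \/ exists2 X, 0 < cut_slope X
                     & t = (2 * (cut_offset X)%:Z)%:~R / (cut_slope X)%:~R].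
Proof.
move=> r_ge2 f_circ f_val.
have [//|//|X|t [t_ge2 t_le t_sol t_eq]] := @ex_affine_solution_le R _
    (fun X => (cut_slope X)%:~R) (fun X => (2 * (cut_offset X)%:Z)%:~R) 2 r.
  rewrite ler0z mulr_ge0 //= intrM.
  have := circulation_cut_slack_ge0 X f_circ f_val.
  by rewrite cut_slack_lower_upper; lra.
exists t; split=> //.
  have [|X|g [g_circ g_val _]] :=
    @hoffman_circulation _ _ D (lowers t) (uppers t).
  - by move=> e; apply: lower_le_upper.
  - by have := t_sol X; rewrite cut_slack_lower_upper intrM; lra.
  - by exists g.
case: t_eq => [|[X X_gt0]]; first by left.
by right; exists X; rewrite // -(ltr0z R).
Qed.

End CutFraction.

Lemma ex_bounded_flow_fraction_le r :
  (0 < #|edge G|)%N -> admits_circular_flow sigma r ->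
  exists2 t, bounded_flow_fractions R sigma t & t <= r.
Proof.
move=> E_gt0 [r_ge2 [D [f f_flow]]].
have ex_interval e :
    exists k, lower (sigma e) k r <= f e <= upper (sigma e) k r.
  apply/closed_value_intervalP => //.
  exact: circular_flow_closed_value f_flow.
have [k f_val] := boolp.choice ex_interval; have [_ _ _ f_circ] := f_flow.
have [t [t_ge2 t_le [g g_circ g_val] t_eq]] :=
  ex_interval_circulation_le r_ge2 f_circ f_val.
have [|h h_flow] := ex_circular_flow_of_closed_value t_ge2 g_circ.
  by move=> e; apply/closed_value_intervalP => //; exists (k e).
have t_admits : admits_circular_flow sigma t by split=> //; exists D, h.
exists t => //; case: t_eq => [t2|[X X_gt0 t_frac]].
  exists 2, 1; have <- : t = 2%:~R / 1%:~R by rewrite divr1 t2.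
  by split=> //; lia.
exists (2 * (cut_offset D k X)%:Z), (cut_slope D k X); rewrite -t_frac.
have offset_le := cut_offset_le D k X; split=> //; [lia | | lia].
by rewrite -(ler_int R) intrM -ler_pdivlMr ?ltr0z // -t_frac.
Qed.

Lemma ex_bounded_flow_fractions_minimum t :
  bounded_flow_fractions R sigma t ->
  exists m, is_minimum (bounded_flow_fractions R sigma) m.
Proof.
pose n := (2 * #|edge G|)%N.
pose frac (i : 'I_n.+1 * 'I_n.+1) : R := i.1%:R / i.2%:R.
pose P i := `[< bounded_flow_fractions R sigma (frac i) >].
have ex_frac t' : bounded_flow_fractions R sigma t' -> exists i, t' = frac i.
  move=> [p [q [q_gt0 qp p_le -> _]]].
  have [p_lt q_lt] : (`|p| < n.+1)%N /\ (`|q| < n.+1)%N by rewrite /n; lia.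
  exists (Ordinal p_lt, Ordinal q_lt); rewrite /frac /= !natr_absz.
  by rewrite !ger0_norm //; lia.
move=> t_frac; have [i0 t_eq] := ex_frac t t_frac.
have Pi0 : P i0 by apply/asboolP; rewrite -t_eq.
case: (arg_minP frac Pi0) => i /asboolP i_frac i_min.
exists (frac i); split=> // t' t'_frac; have [j t'_eq] := ex_frac t' t'_frac.
by rewrite t'_eq i_min //; apply/asboolP; rewrite -t'_eq.
Qed.

End CircularFlow.

Theorem theorem3p9 (R : realType) (G : multigraph) (sigma : edge G -> sign)
    (no_positive_bridge : forall e : edge G, ~ positive_bridge sigma e) :
  ((0 < #|edge G|)%N ->
     is_minimum (bounded_flow_fractions R sigma) (circular_flow_index R sigma))
  /\ (exists x : rat, circular_flow_index R sigma = ratr x).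
Proof.
have [r r_admits] := ex_admits_circular_flow R no_positive_bridge.
have [E_eq0|E_gt0] := posnP #|edge G|.
  split=> //; exists 2; rewrite ratr_nat; apply: inf_minimum.
  split=> [|r' [] //]; have [_ [D [f [_ _ _ f_circ]]]] := r_admits.
  by split=> //; exists D, f; split=> // e; have := fintype0 e E_eq0.
have [t t_frac _] := ex_bounded_flow_fraction_le E_gt0 r_admits.
have [m [m_frac m_lb]] := ex_bounded_flow_fractions_minimum t_frac.
have -> : circular_flow_index R sigma = m.
  apply: inf_minimum; split; first by have [p [q [_ _ _ ->]]] := m_frac.
  move=> r' /(ex_bounded_flow_fraction_le E_gt0)[t' /m_lb m_le].
  exact: le_trans.
split=> [_|]; first by split.
have [p [q [_ _ _ -> _]]] := m_frac.
by exists (p%:~R / q%:~R); rewrite fmorph_div /= !ratr_int.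
Qed.
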